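(* Let $k$ be an algebraically closed field of characteristic zero and $H$ a finite-dimensional ribbon Hopf $k$-algebra. The coadjoint $H$-bimodule $K=H^*\otimes_k H^*$ together with the family of morphisms $\iota_X\colon X^\vee\otimes X\to K$, for $X\in H\text{-Bimod}$, given by $$\iota_X(\xi\otimes x)(a\otimes b)=\xi(a.x.b)\qquad(\xi\in X^*,\ x\in X,\ a,b\in H)$$ (elements of $K$ being regarded as linear forms on $H\otimes H$), is the coend of the functor $$\otimes\circ(?^\vee\times\mathrm{Id})\colon\ H\text{-Bimod}^{\mathrm{op}}\times H\text{-Bimod}\to H\text{-Bimod},\qquad (X,Y)\mapsto X^\vee\otimes Y .$$ That is, $(K,\iota)=\int^{X}X^\vee\otimes X$.
   Context: $H=(H,m,\eta,\Delta,\varepsilon,S)$, Sweedler notation $\Delta(h)=h_{(1)}\otimes h_{(2)}$. Ribbon Hopf algebra: endowed with an invertible $R\in H\otimes H$ satisfying $\Delta^{\mathrm{op}}(h)=R\,\Delta(h)R^{-1}$, $(\Delta\otimes\mathrm{id})(R)=R_{13}R_{23}$, $(\mathrm{id}\otimes\Delta)(R)=R_{13}R_{12}$, and with a central invertible $v$ satisfying $S(v)=v$, $\varepsilon(v)=1$, $\Delta(v)=(v\otimes v)(R_{21}R)^{-1}$. $H\text{-Bimod}$ is the category of finite-dimensional $H$-bimodules with tensor product $X\otimes_k Y$, $h.(x\otimes y)=h_{(1)}.x\otimes h_{(2)}.y$, $(x\otimes y).h=x.h_{(1)}\otimes y.h_{(2)}$. The (right) dual $X^\vee$ is $X^*=\mathrm{Hom}_k(X,k)$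 with $(h.\xi)(x)=\xi(S(h).x)$ and $(\xi.h)(x)=\xi(x.S^{-1}(h))$; on morphisms $f^\vee=f^*$ is the transpose. The coadjoint bimodule $K$ is $H^*\otimes_k H^*$ (linear forms $f$ on $H\otimes H$) with the left coadjoint action on the first factor and the right coadjoint action on the second: $(h.f)(a\otimes b)=f(S(h_{(1)})\,a\,h_{(2)}\otimes b)$ and $(f.h)(a\otimes b)=f(a\otimes h_{(2)}\,b\,S^{-1}(h_{(1)}))$. A dinatural transformation from a functor $G\colon\mathcal C^{\mathrm{op}}\times\mathcal C\to\mathcal D$ to $B\in\mathcal D$ is a family $\varphi_X\colon G(X,X)\to B$ with $\varphi_Y\circ G(\mathrm{id}_Y,f)=\varphi_X\circ G(f,\mathrm{id}_X)$ for all $f\colon X\to Y$. A coend of $G$ is an initial such pair $(A,\iota)$: for every dinatural transformation $(B,\varphi)$ there is a unique morphism $\kappa\colon A\to B$ with $\kappa\circ\iota_X=\varphi_X$ for all $X$. *)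

(* Defs.v *)
Set Warnings "-notation-overridden,-ambiguous-paths".
Set Warnings "-projection-no-head-constant,-redundant-canonical-projection".
From HB Require Import structures.
From mathcomp Require Import all_boot all_order all_algebra all_field.
From mathcomp Require Import boolp.

Set Implicit Arguments.
Unset Strict Implicit.
Unset Printing Implicit Defensive.

Import GRing.Theory.
Import VectorInternalTheory.

Local Open Scope ring_scope.

Reserved Notation "v ⊗ w" (at level 45, left associativity).

(* V (x) W is modelled by the matrices whose (i, j) entry is the coordinate   *)
(* on e_i (x) e_j, where e is the coordinate basis built in a vectType. Its   *)
(* universal property is given by tliftE and tensor_eqP below.                *)
Record tensor (k : fieldType) (V W : vectType k) : Type :=
  Tensor { tensor_mx : 'M[k]_(dim V, dim W) }.

Section TensorVect.
Variables (k : fieldType) (V W : vectType k).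

HB.instance Definition _ := [isNew for @tensor_mx k V W].
HB.instance Definition _ := [Choice of tensor V W by <:].

Definition tensor_add (s t : tensor V W) := Tensor (tensor_mx s + tensor_mx t).
Definition tensor_opp (s : tensor V W) := Tensor (- tensor_mx s).
Definition tensor_scale (c : k) (s : tensor V W) := Tensor (c *: tensor_mx s).

Fact tensor_addA : associative tensor_add.
Proof. by move=> s t u; congr Tensor; apply: addrA. Qed.
Fact tensor_addC : commutative tensor_add.
Proof. by move=> s t; congr Tensor; apply: addrC. Qed.
Fact tensor_add0 : left_id (Tensor 0) tensor_add.
Proof. by case=> s; congr Tensor; apply: add0r. Qed.
Fact tensor_addN : left_inverse (Tensor 0) tensor_opp tensor_add.
Proof. by move=> s; congr Tensor; apply: addNr. Qed.

HB.instance Definition _ := GRing.isZmodule.Build (tensor V W)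
  tensor_addA tensor_addC tensor_add0 tensor_addN.

Fact tensor_scaleA c d s :
  tensor_scale c (tensor_scale d s) = tensor_scale (c * d) s.
Proof. by congr Tensor; apply: scalerA. Qed.
Fact tensor_scale1 : left_id 1 tensor_scale.
Proof. by case=> s; congr Tensor; apply: scale1r. Qed.
Fact tensor_scaleDr : right_distributive tensor_scale +%R.
Proof. by move=> c s t; congr Tensor; apply: scalerDr. Qed.
Fact tensor_scaleDl s : {morph tensor_scale^~ s : c d / c + d}.
Proof. by move=> c d; congr Tensor; apply: scalerDl. Qed.

HB.instance Definition _ := GRing.Zmodule_isLmodule.Build k (tensor V W)
  tensor_scaleA tensor_scale1 tensor_scaleDr tensor_scaleDl.

Fact tensor_mx_linear : linear (@tensor_mx k V W). Proof. by []. Qed.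

HB.instance Definition _ := GRing.isLinear.Build k (tensor V W)
  'M[k]_(dim V, dim W) *:%R (@tensor_mx k V W) tensor_mx_linear.

Fact tensor_vect_iso : Vector.axiom (dim V * dim W)%N (tensor V W).
Proof.
exists (fun t => mxvec (tensor_mx t)); first by move=> c s t; rewrite !linearP.
exists (fun r => Tensor (vec_mx r)) => [[m]|r] /=; first by rewrite mxvecK.
by rewrite vec_mxK.
Qed.

HB.instance Definition _ :=
  Lmodule_hasFinDim.Build k (tensor V W) tensor_vect_iso.

End TensorVect.

Definition tens (k : fieldType) (V W : vectType k) (v : V) (w : W) :
  tensor V W := Tensor ((v2r v)^T *m v2r w).

Notation "v ⊗ w" := (tens v w) : ring_scope.

Definition stdvec (k : fieldType) (V : vectType k) (i : 'I_(dim V)) : V :=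
  r2v (delta_mx 0 i).

Definition bilinear_map (k : fieldType) (V W U : vectType k)
    (f : V -> W -> U) : Prop :=
  (forall w, linear (f^~ w)) /\ (forall v, linear (f v)).

(* The linear map V (x) W -> U induced by f : V -> W -> U; it is meaningful   *)
(* when f is bilinear, in which case tlift f (v (x) w) = f v w.               *)
Definition tlift (k : fieldType) (V W U : vectType k) (f : V -> W -> U) :
    'Hom(tensor V W, U) :=
  linfun (fun t : tensor V W =>
    \sum_i \sum_j tensor_mx t i j *: f (stdvec i) (stdvec j)).

Section TensorTheory.
Variable k : fieldType.
Implicit Types V W U : vectType k.

Lemma linfunP V W (f : V -> W) : linear f -> linfun f =1 f.
Proof.
move=> lf x; pose mf := GRing.isLinear.Build k V W *:%R f lf.
pose F : {linear V -> W} := HB.pack f mf.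
exact: (lfunE F x).
Qed.

Lemma tliftK V W U (f : V -> W -> U) (t : tensor V W) :
  tlift f t = \sum_(p : 'I_(dim V) * 'I_(dim W))
    tensor_mx t p.1 p.2 *: f (stdvec p.1) (stdvec p.2).
Proof.
rewrite /tlift linfunP ?pair_bigA // => c s u; rewrite scaler_sumr -big_split /=.
apply: eq_bigr => i _; rewrite scaler_sumr -big_split /=.
by apply: eq_bigr => j _; rewrite !mxE scalerDl scalerA.
Qed.

Lemma stdvec_sum V (v : V) : v = \sum_i (v2r v) 0 i *: stdvec i.
Proof.
apply: v2r_inj; rewrite linear_sum /= {1}[v2r v]row_sum_delta.
by apply: eq_bigr => i _; rewrite linearZ /= r2vK.
Qed.

Lemma tens_linl V W (w : W) : linear (fun v : V => v ⊗ w).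
Proof.
by move=> c u v; congr Tensor; rewrite !linearP /= mulmxDl -scalemxAl.
Qed.

Lemma tens_linr V W (v : V) : linear (fun w : W => v ⊗ w).
Proof. by move=> c u w; congr Tensor; rewrite !linearP. Qed.

Lemma linZ V W (f : V -> W) c v : linear f -> f (c *: v) = c *: f v.
Proof. by move=> lf; rewrite -(linfunP lf) linearZ /= linfunP. Qed.

Lemma lin_sum V W (f : V -> W) I (r : seq I) (c : I -> k) (v : I -> V) :
  linear f -> f (\sum_(i <- r) c i *: v i) = \sum_(i <- r) c i *: f (v i).
Proof.
move=> lf; rewrite -(linfunP lf) linear_sum; apply: eq_bigr => i _.
by rewrite linearZ /= linfunP.
Qed.

Lemma tliftE V W U (f : V -> W -> U) : bilinear_map f ->
  forall v w, tlift f (v ⊗ w) = f v w.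
Proof.
case=> f1 f2 v w; rewrite tliftK -(pair_bigA _ (fun i j => tensor_mx (v ⊗ w) i j
  *: f (stdvec i) (stdvec j))) /= [in RHS](stdvec_sum v) (lin_sum _ _ _ (f1 w)).
apply: eq_bigr => i _; rewrite [in RHS](stdvec_sum w) (lin_sum _ _ _ (f2 _)).
rewrite scaler_sumr; apply: eq_bigr => j _.
by rewrite scalerA !mxE big_ord1 mxE.
Qed.

Lemma tlift_tens V W (t : tensor V W) : tlift (fun v w => v ⊗ w) t = t.
Proof.
apply: val_inj; rewrite tliftK /= linear_sum [RHS]matrix_sum_delta /=.
rewrite pair_bigA; apply: eq_bigr => p _ /=; congr (_ *: _).
by rewrite !r2vK trmx_delta mul_delta_mx.
Qed.

Lemma lin_tlift V W U U' (g : U -> U') (f : V -> W -> U) t :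
  linear g -> g (tlift f t) = tlift (fun v w => g (f v w)) t.
Proof. by move=> lg; rewrite !tliftK lin_sum. Qed.

Lemma eq_tlift V W U (f g : V -> W -> U) t :
  (forall v w, f v w = g v w) -> tlift f t = tlift g t.
Proof. by move=> fg; rewrite !tliftK; apply: eq_bigr => p _; rewrite fg. Qed.

Lemma tensor_eqP V W U (f g : tensor V W -> U) :
  linear f -> linear g -> (forall v w, f (v ⊗ w) = g (v ⊗ w)) -> f =1 g.
Proof.
move=> lf lg fg t; rewrite -[t]tlift_tens !lin_tlift //.
exact: eq_tlift.
Qed.

Lemma lin_id V : linear (fun v : V => v). Proof. by move=> c u v. Qed.

Lemma lin_comp V W U (f : V -> W) (g : W -> U) :
  linear f -> linear g -> linear (fun v => g (f v)).
Proof. by move=> lf lg c u v; rewrite lf lg. Qed.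

Lemma lin_lfun V W U (f : V -> W) (g : 'Hom(W, U)) :
  linear f -> linear (fun v => g (f v)).
Proof. by move=> lf c u v; rewrite lf linearP. Qed.

Lemma lin_eval V W U (f : V -> 'Hom(W, U)) w :
  linear f -> linear (fun v => f v w).
Proof. by move=> lf c u v; rewrite lf add_lfunE scale_lfunE. Qed.

Lemma lin_linfun V W U (f : V -> W -> U) : bilinear_map f ->
  linear (fun v => linfun (f v)).
Proof.
move=> [f1 f2] c u v; apply/lfunP => w.
rewrite add_lfunE scale_lfunE !(linfunP (f2 _)).
exact: (f1 w).
Qed.

Lemma lin_tensl V W U (f : V -> W) (w : U) :
  linear f -> linear (fun v => f v ⊗ w).
Proof. by move=> lf c u v; rewrite lf (tens_linl w). Qed.

Lemma lin_tensr V W U (f : V -> W) (w : U) :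
  linear f -> linear (fun v => w ⊗ f v).
Proof. by move=> lf c u v; rewrite lf (tens_linr w). Qed.

Lemma lin_tlift_param V W U V' (f : V' -> V -> W -> U) t :
  (forall v w, linear (fun x => f x v w)) -> linear (fun x => tlift (f x) t).
Proof.
move=> lf c x y; rewrite !tliftK scaler_sumr -big_split; apply: eq_bigr => p _.
by rewrite /= lf scalerDr !scalerA mulrC.
Qed.

Lemma lin_tlift_hom V W U V' (f : V' -> V -> W -> U) :
  (forall v w, linear (fun x => f x v w)) -> linear (fun x => tlift (f x)).
Proof.
move=> lf c x y; apply/lfunP => t; rewrite add_lfunE scale_lfunE.
exact: (lin_tlift_param t lf).
Qed.

Lemma lin_scale V W (f : V -> W) c : linear f -> linear (fun v => c *: f v).
Proof.
by move=> lf d u v; rewrite lf scalerDr !scalerA mulrC.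
Qed.

Lemma lin_scalel V W (f : V -> k^o) (w : W) :
  linear f -> linear (fun v => (f v : k) *: w).
Proof. by move=> lf d u v; rewrite lf scalerDl -scalerA. Qed.

Lemma lin_mull V (A : falgType k) (f : V -> A) a :
  linear f -> linear (fun v => f v * a).
Proof. by move=> lf c u v; rewrite lf mulrDl scalerAl. Qed.

Lemma lin_mulr V (A : falgType k) (f : V -> A) a :
  linear f -> linear (fun v => a * f v).
Proof. by move=> lf c u v; rewrite lf mulrDr scalerAr. Qed.

Lemma tlift_exchange V W U V' W' (f : V -> W -> V' -> W' -> U) s t :
  tlift (fun a b => tlift (fun c d => f a b c d) t) s
  = tlift (fun c d => tlift (fun a b => f a b c d) s) t.
Proof.
rewrite !tliftK.
under eq_bigr => p _ do rewrite tliftK scaler_sumr.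
rewrite exchange_big; apply: eq_bigr => q _; rewrite tliftK scaler_sumr /=.
by apply: eq_bigr => p _; rewrite !scalerA mulrC.
Qed.

End TensorTheory.

Ltac lin_step :=
  first
  [ assumption
  | match goal with
    | |- bilinear_map _ => split => ? /=
    | |- linear (fun x => x) => exact: lin_id
    | |- linear (fun x => @?F x ⊗ _) => apply: (@lin_tensl _ _ _ _ F)
    | |- linear (fun x => _ ⊗ @?F x) => apply: (@lin_tensr _ _ _ _ F)
    | |- linear (fun x => @?F x * _) => apply: (@lin_mull _ _ _ F)
    | |- linear (fun x => _ * @?F x) => apply: (@lin_mulr _ _ _ F)
    | |- linear (fun x => _ *: @?F x) => apply: (@lin_scale _ _ _ F)
    | |- linear (fun x => @?F x *: _) => apply: (@lin_scalel _ _ _ F)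
    | |- linear (fun x => fun_of_lfun (linfun (@?F x)) _) =>
        apply: lin_eval; apply: (@lin_linfun _ _ _ _ F)
    | |- linear (fun x => linfun (@?F x)) => apply: (@lin_linfun _ _ _ _ F)
    | |- linear (fun x => fun_of_lfun (tlift (@?F x)) ?t) =>
        apply: (@lin_tlift_param _ _ _ _ _ F t) => ? ? /=
    | |- linear (fun x => tlift (@?F x)) =>
        apply: (@lin_tlift_hom _ _ _ _ _ F) => ? ? /=
    | |- linear (fun x => fun_of_lfun ?g (@?F x)) =>
        apply: (@lin_lfun _ _ _ _ F g)
    | |- linear (fun_of_lfun _) => move=> ? ? ?; exact: linearP
    | |- linear (fun x => fun_of_lfun (@?F x) ?t) =>
        apply: (@lin_eval _ _ _ _ F t)
    end ].
Ltac lin := repeat lin_step.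

Section TensorMaps.
Variable k : fieldType.
Implicit Types V W U : vectType k.

Definition tmap V W V' W' (f : 'Hom(V, V')) (g : 'Hom(W, W')) :
    'Hom(tensor V W, tensor V' W') := tlift (fun v w => f v ⊗ g w).

Definition tswap V W : 'Hom(tensor V W, tensor W V) :=
  tlift (fun v w => w ⊗ v).

Definition tassoc V W U :
    'Hom(tensor (tensor V W) U, tensor V (tensor W U)) :=
  tlift (fun t u => tlift (fun v w => v ⊗ (w ⊗ u)) t).

Lemma tmapE V W V' W' (f : 'Hom(V, V')) (g : 'Hom(W, W')) v w :
  tmap f g (v ⊗ w) = f v ⊗ g w.
Proof. by rewrite tliftE //; lin. Qed.

Lemma tswapE V W (v : V) (w : W) : tswap V W (v ⊗ w) = w ⊗ v.
Proof. by rewrite tliftE //; lin. Qed.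

Lemma tassocE V W U (v : V) (w : W) (u : U) :
  tassoc V W U (v ⊗ w ⊗ u) = v ⊗ (w ⊗ u).
Proof. by rewrite !tliftE; lin. Qed.

End TensorMaps.

Section TensorAlgebra.
Variables (k : fieldType) (A B : falgType k).

Definition tensor_one : tensor A B := 1 ⊗ 1.
Definition tensor_mul (s t : tensor A B) : tensor A B :=
  tlift (fun a b => tlift (fun c d => (a * c) ⊗ (b * d)) t) s.

Lemma tensor_mulE a b c d : tensor_mul (a ⊗ b) (c ⊗ d) = (a * c) ⊗ (b * d).
Proof. by rewrite /tensor_mul !tliftE; lin. Qed.

Lemma tensor_mul_linl t : linear (tensor_mul^~ t).
Proof. by rewrite /tensor_mul; lin. Qed.

Lemma tensor_mul_linr s : linear (tensor_mul s).
Proof. by rewrite /tensor_mul /=; lin. Qed.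

Lemma lin_tmull (V : vectType k) (f : V -> tensor A B) t :
  linear f -> linear (fun x : V => tensor_mul (f x) t).
Proof. by move=> lf; apply: (lin_comp lf); apply: tensor_mul_linl. Qed.

Lemma lin_tmulr (V : vectType k) (f : V -> tensor A B) t :
  linear f -> linear (fun x : V => tensor_mul t (f x)).
Proof. by move=> lf; apply: (lin_comp lf); apply: tensor_mul_linr. Qed.

Fact tensor_mulA : associative tensor_mul.
Proof.
move=> s t u.
move: s; apply: tensor_eqP => [||a b].
- exact: tensor_mul_linl.
- by do 2!apply: lin_tmull; lin.
move: t; apply: tensor_eqP => [||c d].
- by apply: lin_tmulr; apply: lin_tmull; lin.
- by apply: lin_tmull; apply: lin_tmulr; lin.
move: u; apply: tensor_eqP => [||e f].
- by do 2!apply: lin_tmulr; lin.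
- exact: tensor_mul_linr.
by rewrite !tensor_mulE !mulrA.
Qed.

Fact tensor_mul1l : left_id tensor_one tensor_mul.
Proof.
apply: tensor_eqP => [||a b]; [exact: tensor_mul_linr|exact: lin_id|].
by rewrite tensor_mulE !mul1r.
Qed.

Fact tensor_mul1r : right_id tensor_one tensor_mul.
Proof.
apply: tensor_eqP => [||a b]; [exact: tensor_mul_linl|exact: lin_id|].
by rewrite tensor_mulE !mulr1.
Qed.

Fact tensor_mulDl : left_distributive tensor_mul +%R.
Proof.
by move=> s t u; have := tensor_mul_linl u 1 s t; rewrite !scale1r.
Qed.

Fact tensor_mulDr : right_distributive tensor_mul +%R.
Proof.
by move=> u s t; have := tensor_mul_linr u 1 s t; rewrite !scale1r.
Qed.

Fact tensor_one_neq0 : tensor_one != 0.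
Proof.
apply/eqP => /(congr1 (@tensor_mx k A B))/= E.
have nz (C : falgType k) : exists i, v2r (1 : C) 0 i != 0.
  apply/existsP; apply: contraNT (oner_neq0 C); rewrite negb_exists => /forallP z.
  apply/eqP/v2r_inj; rewrite linear0; apply/rowP => i; rewrite mxE.
  by apply/eqP; rewrite -[_ == _]negbK z.
have [[i ni] [j nj]] := (nz A, nz B).
have /eqP := congr1 (fun m : 'M_(_, _) => m i j) E.
by rewrite !mxE big_ord1 mxE mulf_eq0 (negPf ni) (negPf nj).
Qed.

HB.instance Definition _ := GRing.Zmodule_isNzRing.Build (tensor A B)
  tensor_mulA tensor_mul1l tensor_mul1r tensor_mulDl tensor_mulDr
  tensor_one_neq0.

Fact tensor_scaleAl (c : k) (s t : tensor A B) : c *: (s * t) = (c *: s) * t.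
Proof.
by symmetry; apply: (linZ c s (tensor_mul_linl t)).
Qed.

HB.instance Definition _ := GRing.Lmodule_isLalgebra.Build k (tensor A B)
  tensor_scaleAl.

Fact tensor_scaleAr (c : k) (s t : tensor A B) : c *: (s * t) = s * (c *: t).
Proof.
by symmetry; apply: (linZ c t (tensor_mul_linr s)).
Qed.

HB.instance Definition _ := GRing.Lalgebra_isAlgebra.Build k (tensor A B)
  tensor_scaleAr.

HB.instance Definition _ := Algebra_isFalgebra.Build k (tensor A B).

Lemma tensM (a c : A) (b d : B) : (a ⊗ b) * (c ⊗ d) = (a * c) ⊗ (b * d).
Proof. exact: tensor_mulE. Qed.

Lemma tens11 : (1 : A) ⊗ (1 : B) = 1. Proof. by []. Qed.

End TensorAlgebra.

HB.mixin Record isHopfAlgebra (k : fieldType) H of Falgebra k H := {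
  comul : 'Hom(H, tensor H H);
  counit : 'Hom(H, k^o);
  antipode : 'End(H);
  comulA : forall h,
    tassoc H H H (tmap comul \1%VF (comul h)) = tmap \1%VF comul (comul h);
  comul_counitl : forall h, tlift (fun a b => (counit a : k) *: b) (comul h) = h;
  comul_counitr : forall h, tlift (fun a b => (counit b : k) *: a) (comul h) = h;
  comulM : forall g h, comul (g * h) = comul g * comul h;
  comul1 : comul 1 = 1;
  counitM : forall g h, counit (g * h) = counit g * counit h;
  counit1 : counit 1 = 1;
  antipodel : forall h,
    tlift (fun a b => antipode a * b) (comul h) = (counit h : k) *: 1;
  antipoder : forall h,
    tlift (fun a b => a * antipode b) (comul h) = (counit h : k) *: 1
}.

#[short(type="hopfAlgType")]
HB.structure Definition HopfAlgebra (k : fieldType) :=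
  { H of Falgebra k H & isHopfAlgebra k H }.

(* For t = sum a_i (x) b_i in H (x) H, the elements t_12, t_13 and t_23 of the *)
(* algebra (H (x) H) (x) H.                                                   *)
Definition leg12 (k : fieldType) (H : falgType k) :
    'Hom(tensor H H, tensor (tensor H H) H) := tlift (fun a b => a ⊗ b ⊗ 1).
Definition leg13 (k : fieldType) (H : falgType k) :
    'Hom(tensor H H, tensor (tensor H H) H) := tlift (fun a b => a ⊗ 1 ⊗ b).
Definition leg23 (k : fieldType) (H : falgType k) :
    'Hom(tensor H H, tensor (tensor H H) H) := tlift (fun a b => 1 ⊗ a ⊗ b).

HB.mixin Record isRibbon (k : fieldType) H of HopfAlgebra k H := {
  Rmx : tensor H H;
  ribbon : H;
  Rmx_unit : Rmx \is a GRing.unit;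
  Rmx_comul : forall h, tswap H H (comul h) = Rmx * comul h * Rmx^-1;
  Rmx_comull : tmap comul \1%VF Rmx = leg13 H Rmx * leg23 H Rmx;
  Rmx_comulr :
    tmap \1%VF comul Rmx = tassoc H H H (leg13 H Rmx * leg12 H Rmx);
  ribbon_central : forall h, ribbon * h = h * ribbon;
  ribbon_unit : ribbon \is a GRing.unit;
  ribbon_antipode : antipode ribbon = ribbon;
  ribbon_counit : counit ribbon = 1;
  ribbon_comul : comul ribbon = (ribbon ⊗ ribbon) * (tswap H H Rmx * Rmx)^-1
}.

#[short(type="ribbonHopfAlgType")]
HB.structure Definition RibbonHopfAlgebra (k : fieldType) :=
  { H of HopfAlgebra k H & isRibbon k H }.

(* Sweedler notation: sweedler (fun h1 h2 => E) h is E with h_(1) for h1 and  *)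
(* h_(2) for h2, where E must be bilinear in h1 and h2.                       *)
Definition sweedler (k : fieldType) (H : hopfAlgType k) (V : vectType k)
  (f : H -> H -> V) (h : H) : V := tlift f (comul h).

Ltac lin_step2 :=
  first [ lin_step | progress rewrite /sweedler /= ].
Ltac slin := repeat lin_step2.

Section HopfTheory.
Variables (k : fieldType) (H : hopfAlgType k).
Implicit Types (V : vectType k) (g h x y : H).
Local Notation S := (@antipode k H).
Local Notation sw := sweedler.

Lemma eq_sweedler V (f f' : H -> H -> V) h :
  (forall a b, f a b = f' a b) -> sw f h = sw f' h.
Proof. exact: eq_tlift. Qed.

Lemma sweedler_lin V (f : H -> H -> V) : linear (sw f).
Proof. by slin. Qed.

Lemma sweedlerA V (f : H -> H -> H -> V) h :
    (forall a b, linear (f a b)) -> (forall a c, linear (f a ^~ c)) ->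
    (forall b c, linear (fun a => f a b c)) ->
  sw (fun a b => sw (fun c d => f a c d) b) h
  = sw (fun a b => sw (fun c d => f c d b) a) h.
Proof.
move=> f3 f2 f1.
pose F : 'Hom(tensor H (tensor H H), V) := tlift (fun a t => tlift (f a) t).
have lF : bilinear_map (fun a (t : tensor H H) => tlift (f a) t).
  by split=> [t|a]; lin; apply: f1.
have bf a : bilinear_map (f a) by split.
have := congr1 F (comulA h); rewrite /tmap.
have lG (G : 'Hom(tensor (tensor H H) H, tensor H (tensor H H))) : linear G by lin.
rewrite (lin_tlift _ _ (lG _)) [F _](lin_tlift _ _ (g := F)); last by lin.
rewrite [in F _](lin_tlift _ _ (g := F)); last by lin.
move=> E; symmetry; apply: etrans; last apply: etrans E _.
- apply: eq_tlift => a b; rewrite id_lfunE.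
  have lK : linear (fun t => F (tassoc H H H (t ⊗ b))) by lin.
  rewrite -[comul a]tlift_tens (lin_tlift _ _ lK).
  apply: eq_tlift => c d; rewrite tassocE /F tliftE // tliftE //.
- apply: eq_tlift => a b; rewrite id_lfunE /F tliftE //.
Qed.

Lemma sweedlerM V (f : H -> H -> V) x y : bilinear_map f ->
  sw f (x * y) = sw (fun a b => sw (fun c d => f (a * c) (b * d)) y) x.
Proof.
move=> bf; rewrite /sweedler comulM.
have lf : linear (tlift f) by lin.
rewrite -[_ * _]/(tensor_mul _ _) /tensor_mul (lin_tlift _ _ lf).
apply: eq_tlift => a b; rewrite (lin_tlift _ _ lf); apply: eq_tlift => c d.
by rewrite tliftE.
Qed.

Lemma sweedler1 V (f : H -> H -> V) : bilinear_map f -> sw f 1 = f 1 1.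
Proof. by move=> bf; rewrite /sweedler comul1 -tens11 tliftE. Qed.

Lemma sweedlerCl V (f : H -> V) h : linear f ->
  sw (fun a b => (counit a : k) *: f b) h = f h.
Proof.
move=> lf; rewrite -[in RHS](comul_counitl h) (lin_tlift _ _ lf).
by apply: eq_tlift => a b; rewrite linZ.
Qed.

Lemma sweedlerCr V (f : H -> V) h : linear f ->
  sw (fun a b => (counit b : k) *: f a) h = f h.
Proof.
move=> lf; rewrite -[in RHS](comul_counitr h) (lin_tlift _ _ lf).
by apply: eq_tlift => a b; rewrite linZ.
Qed.

Lemma sweedlerSl V (f : H -> V) h : linear f ->
  sw (fun a b => f (S a * b)) h = (counit h : k) *: f 1.
Proof. by move=> lf; rewrite -linZ // -antipodel (lin_tlift _ _ lf). Qed.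

Lemma sweedlerSr V (f : H -> V) h : linear f ->
  sw (fun a b => f (a * S b)) h = (counit h : k) *: f 1.
Proof. by move=> lf; rewrite -linZ // -antipoder (lin_tlift _ _ lf). Qed.

Lemma antipode1 : S 1 = 1.
Proof.
have := antipodel (1 : H); rewrite comul1 -tens11 tliftE; last by lin.
by rewrite mulr1 counit1 scale1r.
Qed.

Lemma antipodeM x y : S (x * y) = S y * S x.
Proof.
pose F x1 x2 x3 y1 y2 y3 : H := S (x1 * y1) * (x2 * (y2 * S y3) * S x3).
pose L := sw (fun x1 x' => sw (fun x2 x3 => sw (fun y1 y' => sw (fun y2 y3 =>
  F x1 x2 x3 y1 y2 y3) y') y) x') x.
transitivity L.
  rewrite /L; symmetry.
  have E1 x1 x2 x3 y1 y' : sw (fun y2 y3 => F x1 x2 x3 y1 y2 y3) y'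
      = (counit y' : k) *: (S (x1 * y1) * (x2 * S x3)).
    have lf : linear (fun z : H => S (x1 * y1) * (x2 * z * S x3)) by lin.
    by rewrite (sweedlerSr y' lf) mulr1.
  have E2 x1 x' : sw (fun x2 x3 => sw (fun y1 y' => sw (fun y2 y3 =>
      F x1 x2 x3 y1 y2 y3) y') y) x' = (counit x' : k) *: S (x1 * y).
    have lf : linear (fun z : H => S (x1 * y) * z) by lin.
    rewrite -[in RHS](mulr1 (S (x1 * y))) -(sweedlerSr x' lf).
    apply: eq_sweedler => x2 x3.
    have lg : linear (fun y1 : H => S (x1 * y1) * (x2 * S x3)) by lin.
    by rewrite -(sweedlerCr y lg); apply: eq_sweedler => y1 y'.
  rewrite (eq_sweedler _ E2) (@sweedlerCr H (fun x1 => S (x1 * y))) //; lin.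
rewrite /L sweedlerA; [|by move=> *; rewrite /F; slin..].
transitivity (sw (fun a b : H => (counit a : k) *: (S y * S b)) x); last first.
  by rewrite sweedlerCl //; lin.
apply: eq_sweedler => x' x3.
transitivity (sw (fun x1 x2 => sw (fun y' y3 => sw (fun y1 y2 =>
    F x1 x2 x3 y1 y2 y3) y') y) x').
  by apply: eq_sweedler => x1 x2; rewrite sweedlerA // => *; rewrite /F; lin.
rewrite /sweedler tlift_exchange.
transitivity (sw (fun y' y3 =>
    (counit x' : k) *: ((counit y' : k) *: (S y3 * S x3))) y).
  apply: eq_sweedler => y' y3.
  have lf : linear (fun z : H => z * (S y3 * S x3)) by lin.
  have bf : bilinear_map (fun a b => S a * b * (S y3 * S x3)) by lin.
  have := sweedlerM x' y' bf; rewrite (sweedlerSl (x' * y') lf) mul1r counitM.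
  rewrite -scalerA => ->.
  by apply: eq_sweedler => x1 x2; apply: eq_sweedler => y1 y2; rewrite /F !mulrA.
have lf : linear (fun z : H => (counit x' : k) *: (S z * S x3)) by lin.
rewrite -(sweedlerCl y lf); apply: eq_sweedler => y' y3.
by rewrite !scalerA mulrC.
Qed.

End HopfTheory.

Section RibbonTheory.
Variables (k : fieldType) (H : ribbonHopfAlgType k).
Implicit Types (V : vectType k) (h : H).
Local Notation S := (@antipode k H).
Local Notation R := (@Rmx k H).
Local Notation RR f := (tlift f R).

Lemma Rmx_comulrE V (F : H -> H -> H -> V) :
    (forall a b, linear (F a b)) -> (forall a c, linear (F a ^~ c)) ->
    (forall b c, linear (fun a => F a b c)) ->
  RR (fun a b => sweedler (F a) b)
  = RR (fun a b => RR (fun a' b' => F (a * a') b' b)).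
Proof.
move=> F3 F2 F1.
have lF : bilinear_map (fun a (t : tensor H H) => tlift (F a) t).
  by split=> [t|a]; lin; apply: F1.
have bF a : bilinear_map (F a) by split.
pose G : 'Hom(tensor H (tensor H H), V) := tlift (fun a t => tlift (F a) t).
have lG : linear G by lin.
have := congr1 G (@Rmx_comulr k H); rewrite /tmap (lin_tlift _ _ lG) => E.
apply: etrans; last apply: etrans E _.
  by apply: eq_tlift => a b; rewrite id_lfunE /G tliftE.
have l1 : linear (fun t => G (tassoc H H H (t * leg12 H R))) by lin.
rewrite [leg13 H _]/(tlift _ _) (lin_tlift _ _ l1); apply: eq_tlift => a b.
have l2 : linear (fun t => G (tassoc H H H ((a ⊗ 1 ⊗ b) * t))) by lin.
rewrite [leg12 H _]/(tlift _ _) (lin_tlift _ _ l2); apply: eq_tlift => c d.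
by rewrite !tensM mul1r mulr1 tassocE /G !tliftE.
Qed.

Lemma Rmx_comulE V (f : H -> H -> V) h : bilinear_map f ->
  sweedler (fun c d => RR (fun a b => f (d * a) (c * b))) h
  = RR (fun a b => sweedler (fun c d => f (a * c) (b * d)) h).
Proof.
move=> bf; have lf : linear (tlift f) by lin.
have := Rmx_comul h => /(congr1 (fun t => tlift f (t * R))).
rewrite mulrVK ?Rmx_unit // => E.
apply: etrans; last apply: etrans E _.
  have l1 : linear (fun t : tensor H H => tlift f (t * R)) by lin.
  rewrite [tswap _ _ _]/(tlift _ _) (lin_tlift _ _ l1); apply: eq_tlift => c d.
  have l2 : linear (fun t : tensor H H => tlift f ((d ⊗ c) * t)) by lin.
  rewrite -[in RHS](tlift_tens R) (lin_tlift _ _ l2); apply: eq_tlift => a b.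
  by rewrite tensM tliftE.
have l1 : linear (fun t : tensor H H => tlift f (t * comul h)) by lin.
rewrite -[in LHS](tlift_tens R) (lin_tlift _ _ l1); apply: eq_tlift => a b.
have l2 : linear (fun t : tensor H H => tlift f ((a ⊗ b) * t)) by lin.
rewrite -[in LHS](tlift_tens (comul h)) (lin_tlift _ _ l2); apply: eq_tlift => c d.
by rewrite tensM tliftE.
Qed.

Lemma Rmx_counitr : RR (fun a b => (counit b : k) *: a) = 1.
Proof.
set E := RR _.
have RE : R * (E ⊗ 1) = R.
  pose F (a c d : H) : tensor H H := (counit c : k) *: (a ⊗ d).
  transitivity (RR (fun a b => sweedler (F a) b)); last first.
    rewrite -[RHS]tlift_tens; apply: eq_tlift => a b.
    by rewrite (@sweedlerCl _ _ _ (fun z => a ⊗ z)) //; lin.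
  rewrite Rmx_comulrE; try by move=> *; rewrite /F; lin.
  have l1 : linear (fun t : tensor H H => t * (E ⊗ 1)) by lin.
  rewrite -[in LHS](tlift_tens R) (lin_tlift _ _ l1); apply: eq_tlift => a b.
  have l2 : linear (fun t : H => (a ⊗ b) * (t ⊗ 1)) by lin.
  rewrite /E (lin_tlift _ _ l2); apply: eq_tlift => c d.
  by rewrite tensM mulr1 -scalerAr (linZ _ _ (@tens_linl _ _ _ _)).
have E1 : E ⊗ 1 = 1 ⊗ 1 :> tensor H H.
  by apply: (mulrI (@Rmx_unit k H)); rewrite RE tens11 mulr1.
have bc : bilinear_map (fun a b : H => (counit b : k) *: a) by lin.
have := congr1 (tlift (fun a b : H => (counit b : k) *: a)) E1.
by rewrite !tliftE // counit1 !scale1r.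
Qed.

(* Drinfeld's element u satisfies S^2(h) u = u h and has a left inverse, so   *)
(* the antipode is bijective and antipodeV below is its inverse.              *)
Definition drinfeld : H := RR (fun a b => S b * a).
Definition drinfeldV : H := RR (fun a b => b * S (S a)).

Lemma drinfeldJ h : S (S h) * drinfeld = drinfeld * h.
Proof.
have E1 c : (counit c : k) *: drinfeld
    = RR (fun a b => sweedler (fun d e => S (b * e) * (a * d)) c).
  have bf : bilinear_map (fun x y : H => S y * x) by lin.
  rewrite -(Rmx_comulE c bf) /sweedler tlift_exchange.
  have l1 : linear ( *:%R (counit c : k) : H -> H) by apply: lin_scale => //.
  rewrite /drinfeld (lin_tlift _ _ l1); apply: eq_tlift => a b.
  have l2 : linear (fun z => S b * (z * a)) by lin.
  have := sweedlerSl c l2; rewrite mul1r => <-.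
  by apply: eq_sweedler => d e; rewrite antipodeM !mulrA.
have l0 : linear (fun z => S (S z) * drinfeld) by lin.
rewrite -(sweedlerCl h l0).
under eq_sweedler => c e do
  rewrite scalerAr E1 (lin_tlift _ _ (lin_mulr (S (S e)) (@lin_id _ H))).
rewrite /sweedler tlift_exchange.
have l1 : linear (fun z => z * h) by lin.
rewrite /drinfeld (lin_tlift _ _ l1); apply: eq_tlift => a b.
have l2 : linear (fun z => S b * a * z) by lin.
rewrite -(sweedlerCr h l2).
pose F x y z := S (b * (y * S z)) * (a * x).
transitivity (sweedler (fun x c => sweedler (F x) c) h).
  rewrite sweedlerA; try by move=> *; rewrite /F; lin.
  apply: eq_sweedler => c e; rewrite [LHS](lin_tlift _ _ (lin_mulr _ (@lin_id _ H))).
  by apply: eq_sweedler => x y; rewrite /F !antipodeM !mulrA.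
apply: eq_sweedler => x c.
have l3 : linear (fun z => S (b * z) * (a * x)) by lin.
by rewrite (sweedlerSr c l3) mulr1 mulrA.
Qed.

Lemma drinfeldVK : drinfeldV * drinfeld = 1.
Proof.
have l1 : linear (fun z : H => z * drinfeld) by lin.
rewrite /drinfeldV (lin_tlift _ _ l1) -Rmx_counitr.
transitivity (RR (fun a b => sweedler (fun c d => c * S d * a) b)); last first.
  apply: eq_tlift => a b; have l2 : linear (fun z : H => z * a) by lin.
  by rewrite (sweedlerSr b l2) mul1r.
rewrite (@Rmx_comulrE _ (fun a c d => c * S d * a)); try by move=> *; lin.
rewrite tlift_exchange; apply: eq_tlift => a b.
have l2 : linear (fun z : H => b * (z * a)) by lin.
rewrite -mulrA drinfeldJ /drinfeld (lin_tlift _ _ l2).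
by apply: eq_tlift => c d; rewrite !mulrA.
Qed.

Lemma antipode_lker0 : lker S == 0%VS.
Proof.
apply/lker0P => x y /(congr1 S) E; have := congr1 (fun z => z * drinfeld) E.
rewrite /= !drinfeldJ => /(congr1 ( *%R drinfeldV)).
by rewrite !mulrA drinfeldVK !mul1r.
Qed.

Definition antipodeV : 'End(H) := (S^-1)%VF.

Lemma antipodeK : cancel S antipodeV.
Proof. exact: lker0_lfunK antipode_lker0. Qed.

Lemma antipodeVK : cancel antipodeV S.
Proof. exact: lker0_lfunVK antipode_lker0. Qed.

Lemma antipodeV1 : antipodeV 1 = 1.
Proof. by apply: (can_inj antipodeK); rewrite antipodeVK antipode1. Qed.

Lemma antipodeVM x y : antipodeV (x * y) = antipodeV y * antipodeV x.
Proof.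
by apply: (can_inj antipodeK); rewrite antipodeM !antipodeVK.
Qed.

End RibbonTheory.

Record category := Category {
  ob :> Type;
  mor : ob -> ob -> Type;
  idm : forall X, mor X X;
  comp : forall X Y Z, mor Y Z -> mor X Y -> mor X Z;
  comp_idl : forall X Y (f : mor X Y), comp (idm Y) f = f;
  comp_idr : forall X Y (f : mor X Y), comp f (idm X) = f;
  compA : forall W X Y Z (f : mor Y Z) (g : mor X Y) (h : mor W X),
    comp f (comp g h) = comp (comp f g) h
}.

Arguments mor [c] X Y.
Arguments idm [c] X.
Arguments comp [c X Y Z] f g.

Definition op (C : category) : category :=
  @Category C (fun X Y => mor Y X) (fun X => idm X)
    (fun X Y Z f g => comp g f)
    (fun X Y f => comp_idr f) (fun X Y f => comp_idl f)
    (fun W X Y Z f g h => esym (compA h g f)).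

Section ProductCategory.
Variables C D : category.

Definition prod_mor (X Y : C * D) : Type := mor X.1 Y.1 * mor X.2 Y.2.
Definition prod_id (X : C * D) : prod_mor X X := (idm X.1, idm X.2).
Definition prod_comp (X Y Z : C * D) (f : prod_mor Y Z) (g : prod_mor X Y) :
  prod_mor X Z := (comp f.1 g.1, comp f.2 g.2).

Fact prod_comp_idl X Y (f : prod_mor X Y) : prod_comp (prod_id Y) f = f.
Proof. by case: f => f g; congr pair; apply: comp_idl. Qed.
Fact prod_comp_idr X Y (f : prod_mor X Y) : prod_comp f (prod_id X) = f.
Proof. by case: f => f g; congr pair; apply: comp_idr. Qed.
Fact prod_compA W X Y Z (f : prod_mor Y Z) (g : prod_mor X Y)
  (h : prod_mor W X) : prod_comp f (prod_comp g h) = prod_comp (prod_comp f g) h.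
Proof. by congr pair; apply: compA. Qed.

Definition prod_cat : category :=
  Category prod_comp_idl prod_comp_idr prod_compA.

End ProductCategory.

Record functor (C D : category) := Functor {
  fob :> C -> D;
  fmor : forall X Y : C, mor X Y -> mor (fob X) (fob Y);
  fmor_id : forall X, fmor (idm X) = idm (fob X);
  fmor_comp : forall X Y Z (f : mor Y Z) (g : mor X Y),
    fmor (comp f g) = comp (fmor f) (fmor g)
}.

Arguments fmor [C D] _ [X Y] _.

Definition id_functor (C : category) : functor C C :=
  @Functor C C id (fun X Y f => f) (fun X => erefl) (fun X Y Z f g => erefl).

Section FunctorOps.
Variables C D E C' D' : category.

Fact comp_functor_id (G : functor D E) (F : functor C D) X :
  fmor G (fmor F (idm X)) = idm (G (F X)).
Proof. by rewrite !fmor_id. Qed.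
Fact comp_functor_comp (G : functor D E) (F : functor C D) X Y Z
    (f : mor Y Z) (g : mor X Y) :
  fmor G (fmor F (comp f g)) = comp (fmor G (fmor F f)) (fmor G (fmor F g)).
Proof. by rewrite !fmor_comp. Qed.

Definition comp_functor (G : functor D E) (F : functor C D) : functor C E :=
  @Functor C E (fun X => G (F X)) (fun X Y f => fmor G (fmor F f))
    (comp_functor_id G F) (comp_functor_comp G F).

Variables (F : functor C D) (G : functor C' D').

Definition prod_functor_ob (X : prod_cat C C') : prod_cat D D' :=
  (F X.1, G X.2).

Definition prod_functor_mor (X Y : prod_cat C C') (f : mor X Y) :
  mor (prod_functor_ob X) (prod_functor_ob Y) := (fmor F f.1, fmor G f.2).

Fact prod_functor_id X : prod_functor_mor (idm X) = idm (prod_functor_ob X).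
Proof. by rewrite /prod_functor_mor !fmor_id. Qed.
Fact prod_functor_comp X Y Z (f : mor Y Z) (g : mor X Y) :
  prod_functor_mor (comp f g) = comp (prod_functor_mor f) (prod_functor_mor g).
Proof. by rewrite /prod_functor_mor !fmor_comp. Qed.

Definition prod_functor : functor (prod_cat C C') (prod_cat D D') :=
  Functor prod_functor_id prod_functor_comp.

End FunctorOps.

(* The action of a bifunctor C^op x C -> D on f : X' -> X and g : Y -> Y'.    *)
Definition bifmor (C D : category) (G : functor (prod_cat (op C) C) D)
    (X X' Y Y' : C) (f : mor X' X) (g : mor Y Y') :
    mor (G (X, Y)) (G (X', Y')) :=
  @fmor _ _ G (X, Y) (X', Y') (f, g).

Definition dinatural (C D : category) (G : functor (prod_cat (op C) C) D)
    (B : D) (phi : forall X : C, mor (G (X, X)) B) : Prop :=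
  forall (X Y : C) (f : mor X Y),
    comp (phi Y) (bifmor G (idm Y) f) = comp (phi X) (bifmor G f (idm X)).

Definition is_coend (C D : category) (G : functor (prod_cat (op C) C) D)
    (A : D) (iota : forall X : C, mor (G (X, X)) A) : Prop :=
  dinatural iota /\
  forall (B : D) (phi : forall X : C, mor (G (X, X)) B), dinatural phi ->
    exists! kappa : mor A B, forall X : C, comp kappa (iota X) = phi X.

Arguments is_coend [C D] G A iota.

Record bimodule (k : fieldType) (H : falgType k) := Bimodule {
  bimod_vect :> vectType k;
  lact : H -> bimod_vect -> bimod_vect;
  ract : bimod_vect -> H -> bimod_vect;
  lact_bilinear : bilinear_map lact;
  ract_bilinear : bilinear_map ract;
  lact1 : forall x, lact 1 x = x;
  lactM : forall g h x, lact (g * h) x = lact g (lact h x);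
  ract1 : forall x, ract x 1 = x;
  ractM : forall x g h, ract x (g * h) = ract (ract x g) h;
  lractA : forall g x h, ract (lact g x) h = lact g (ract x h)
}.

Record bimod_hom (k : fieldType) (H : falgType k) (X Y : bimodule H) :=
  BimodHom {
    bimod_lfun :> 'Hom(X, Y);
    bimod_homl : forall h x, bimod_lfun (lact h x) = lact h (bimod_lfun x);
    bimod_homr : forall x h, bimod_lfun (ract x h) = ract (bimod_lfun x) h
  }.

Section BimoduleCategory.
Variables (k : fieldType) (H : falgType k).
Implicit Types X Y Z : bimodule H.

Lemma bimod_hom_eq X Y (f g : bimod_hom X Y) : f =1 g -> f = g.
Proof.
case: f g => [f fl fr] [g gl gr] /= /lfunP E; subst g.
by congr BimodHom; apply: Prop_irrelevance.
Qed.

Definition bimod_id X : bimod_hom X X.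
Proof. by exists \1%VF => *; rewrite !id_lfunE. Defined.

Definition bimod_comp X Y Z (f : bimod_hom Y Z) (g : bimod_hom X Y) :
  bimod_hom X Z.
Proof.
by exists (f \o g)%VF => *; rewrite !comp_lfunE (bimod_homl, bimod_homr)
  (bimod_homl, bimod_homr).
Defined.

Fact bimod_comp_idl X Y (f : bimod_hom X Y) : bimod_comp (bimod_id Y) f = f.
Proof. by apply: bimod_hom_eq => x /=; rewrite comp_lfunE id_lfunE. Qed.
Fact bimod_comp_idr X Y (f : bimod_hom X Y) : bimod_comp f (bimod_id X) = f.
Proof. by apply: bimod_hom_eq => x /=; rewrite comp_lfunE id_lfunE. Qed.
Fact bimod_compA W X Y Z (f : bimod_hom Y Z) (g : bimod_hom X Y)
  (h : bimod_hom W X) : bimod_comp f (bimod_comp g h) = bimod_comp (bimod_comp f g) h.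
Proof. by apply: bimod_hom_eq => x /=; rewrite !comp_lfunE. Qed.

Definition Bimod : category :=
  Category bimod_comp_idl bimod_comp_idr bimod_compA.

End BimoduleCategory.

Section LinActions.
Variables (k : fieldType) (H : falgType k) (X : bimodule H) (V : vectType k).

Lemma lin_lactl (f : V -> H) (x : X) :
  linear f -> linear (fun v => lact (f v) x).
Proof. by move=> lf c u v; rewrite lf (lact_bilinear X).1. Qed.
Lemma lin_lactr h (f : V -> X) : linear f -> linear (fun v => lact h (f v)).
Proof. by move=> lf c u v; rewrite lf (lact_bilinear X).2. Qed.
Lemma lin_ractl (f : V -> X) h : linear f -> linear (fun v => ract (f v) h).
Proof. by move=> lf c u v; rewrite lf (ract_bilinear X).1. Qed.
Lemma lin_ractr (x : X) (f : V -> H) :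
  linear f -> linear (fun v => ract x (f v)).
Proof. by move=> lf c u v; rewrite lf (ract_bilinear X).2. Qed.

End LinActions.

Ltac blin_step :=
  first
  [ lin_step2
  | match goal with
    | |- linear (fun x => lact (@?F x) _) => apply: (@lin_lactl _ _ _ _ F)
    | |- linear (fun x => lact _ (@?F x)) => apply: (@lin_lactr _ _ _ _ _ F)
    | |- linear (fun x => ract (@?F x) _) => apply: (@lin_ractl _ _ _ _ F)
    | |- linear (fun x => ract _ (@?F x)) => apply: (@lin_ractr _ _ _ _ _ F)
    end ].
Ltac blin := repeat blin_step.

Section TensorBimodule.
Variables (k : fieldType) (H : hopfAlgType k).
Implicit Types X Y : bimodule H.

Definition tensor_lact X Y (h : H) (t : tensor X Y) : tensor X Y :=
  tlift (fun x y => sweedler (fun h1 h2 => lact h1 x ⊗ lact h2 y) h) t.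
Definition tensor_ract X Y (t : tensor X Y) (h : H) : tensor X Y :=
  tlift (fun x y => sweedler (fun h1 h2 => ract x h1 ⊗ ract y h2) h) t.

Lemma tensor_lact_bilinear X Y : bilinear_map (@tensor_lact X Y).
Proof. by rewrite /tensor_lact; blin. Qed.
Lemma tensor_ract_bilinear X Y : bilinear_map (@tensor_ract X Y).
Proof. by rewrite /tensor_ract; blin. Qed.

Lemma tensor_lactE X Y h (x : X) (y : Y) : tensor_lact h (x ⊗ y)
  = sweedler (fun h1 h2 => lact h1 x ⊗ lact h2 y) h.
Proof. by rewrite /tensor_lact tliftE //; blin. Qed.
Lemma tensor_ractE X Y h (x : X) (y : Y) : tensor_ract (x ⊗ y) h
  = sweedler (fun h1 h2 => ract x h1 ⊗ ract y h2) h.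
Proof. by rewrite /tensor_ract tliftE //; blin. Qed.

Fact tensor_lact1 X Y (t : tensor X Y) : tensor_lact 1 t = t.
Proof.
move: t; apply: tensor_eqP; first exact: (tensor_lact_bilinear X Y).2.
  exact: lin_id.
move=> x y; rewrite tensor_lactE sweedler1 ?lact1 //; blin.
Qed.

Fact tensor_ract1 X Y (t : tensor X Y) : tensor_ract t 1 = t.
Proof.
move: t; apply: tensor_eqP; first exact: (tensor_ract_bilinear X Y).1.
  exact: lin_id.
move=> x y; rewrite tensor_ractE sweedler1 ?ract1 //; blin.
Qed.

Fact tensor_lactM X Y g h (t : tensor X Y) :
  tensor_lact (g * h) t = tensor_lact g (tensor_lact h t).
Proof.
have [_ l] := tensor_lact_bilinear X Y.
move: t; apply: tensor_eqP; [exact: l|exact: lin_comp (l h) (l g)|].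
move=> x y; rewrite !tensor_lactE sweedlerM; last by blin.
rewrite [in RHS]/sweedler (lin_tlift _ _ (l g)) /sweedler tlift_exchange.
apply: eq_tlift => a b; rewrite tensor_lactE; apply: eq_tlift => c d.
by rewrite !lactM.
Qed.

Fact tensor_ractM X Y (t : tensor X Y) g h :
  tensor_ract t (g * h) = tensor_ract (tensor_ract t g) h.
Proof.
have [l _] := tensor_ract_bilinear X Y.
move: t; apply: tensor_eqP; [exact: l|exact: lin_comp (l g) (l h)|].
move=> x y; rewrite !tensor_ractE sweedlerM; last by blin.
rewrite [in RHS]/sweedler (lin_tlift _ _ (l h)); apply: eq_tlift => a b.
by rewrite tensor_ractE; apply: eq_tlift => c d; rewrite !ractM.
Qed.

Fact tensor_lractA X Y g (t : tensor X Y) h :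
  tensor_ract (tensor_lact g t) h = tensor_lact g (tensor_ract t h).
Proof.
have [[_ l] [r _]] := (tensor_lact_bilinear X Y, tensor_ract_bilinear X Y).
move: t; apply: tensor_eqP.
- exact: lin_comp (l g) (r h).
- exact: lin_comp (r h) (l g).
move=> x y; rewrite tensor_lactE tensor_ractE.
rewrite /sweedler (lin_tlift _ _ (l g)) (lin_tlift _ _ (r h)).
under eq_tlift => a b do rewrite tensor_ractE.
under [RHS]eq_tlift => a b do rewrite tensor_lactE.
rewrite /sweedler tlift_exchange; apply: eq_tlift => a b; apply: eq_tlift => c d.
by rewrite !lractA.
Qed.

Definition tensor_bimod X Y : bimodule H :=
  @Bimodule k H (tensor X Y) _ _
    (tensor_lact_bilinear X Y) (tensor_ract_bilinear X Y)
    (@tensor_lact1 X Y) (@tensor_lactM X Y)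
    (@tensor_ract1 X Y) (@tensor_ractM X Y) (@tensor_lractA X Y).

Definition tensor_bimod_mor (X Y : prod_cat (Bimod H) (Bimod H))
    (f : mor X Y) :
  mor (tensor_bimod X.1 X.2 : Bimod H) (tensor_bimod Y.1 Y.2).
Proof.
exists (tmap (f.1 : bimod_hom _ _) (f.2 : bimod_hom _ _)) => [h t|t h] /=.
  have [_ l] := tensor_lact_bilinear X.1 X.2.
  have [_ l'] := tensor_lact_bilinear Y.1 Y.2.
  move: t; apply: tensor_eqP => [||x y].
  - by apply: lin_lfun; apply: l.
  - by apply: lin_comp (l' h); lin.
  rewrite tmapE !tensor_lactE /sweedler lin_tlift; last by lin.
  by apply: eq_tlift => a b; rewrite tmapE !bimod_homl.
have [r _] := tensor_ract_bilinear X.1 X.2.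
have [r' _] := tensor_ract_bilinear Y.1 Y.2.
move: t; apply: tensor_eqP => [||x y].
- by apply: lin_lfun; apply: r.
- by apply: lin_comp (r' h); lin.
rewrite tmapE !tensor_ractE /sweedler lin_tlift; last by lin.
by apply: eq_tlift => a b; rewrite tmapE !bimod_homr.
Defined.

Fact tensor_bimod_mor_id (X : prod_cat (Bimod H) (Bimod H)) : tensor_bimod_mor (idm X) = idm _.
Proof.
apply: bimod_hom_eq; apply: tensor_eqP => [||x y] /=; [by lin|by lin|].
by rewrite tmapE !id_lfunE.
Qed.

Fact tensor_bimod_mor_comp (X Y Z : prod_cat (Bimod H) (Bimod H)) (f : mor Y Z) (g : mor X Y) :
  tensor_bimod_mor (comp f g) = comp (tensor_bimod_mor f) (tensor_bimod_mor g).
Proof.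
apply: bimod_hom_eq; apply: tensor_eqP => [||x y] /=; [by lin|by lin|].
by rewrite comp_lfunE !tmapE !comp_lfunE.
Qed.

Definition tensor_functor : functor (prod_cat (Bimod H) (Bimod H)) (Bimod H) :=
  Functor tensor_bimod_mor_id tensor_bimod_mor_comp.

End TensorBimodule.

Section DualBimodule.
Variables (k : fieldType) (H : ribbonHopfAlgType k).
Implicit Types X Y : bimodule H.
Local Notation S := (@antipode k H).
Local Notation SV := (@antipodeV k H).

Definition dual_lact X (h : H) (xi : 'Hom(X, k^o)) : 'Hom(X, k^o) :=
  linfun (fun x => xi (lact (S h) x)).
Definition dual_ract X (xi : 'Hom(X, k^o)) (h : H) : 'Hom(X, k^o) :=
  linfun (fun x => xi (ract x (SV h))).

Lemma dual_lactE X h (xi : 'Hom(X, k^o)) x :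
  dual_lact h xi x = xi (lact (S h) x).
Proof. by rewrite /dual_lact linfunP //; blin. Qed.
Lemma dual_ractE X (xi : 'Hom(X, k^o)) h x :
  dual_ract xi h x = xi (ract x (SV h)).
Proof. by rewrite /dual_ract linfunP //; blin. Qed.

Lemma dual_lact_bilinear X : bilinear_map (@dual_lact X).
Proof. by rewrite /dual_lact; blin. Qed.
Lemma dual_ract_bilinear X : bilinear_map (@dual_ract X).
Proof. by rewrite /dual_ract; blin. Qed.

Fact dual_lact1 X xi : @dual_lact X 1 xi = xi.
Proof. by apply/lfunP => x; rewrite dual_lactE antipode1 lact1. Qed.
Fact dual_lactM X g h xi :
  @dual_lact X (g * h) xi = dual_lact g (dual_lact h xi).
Proof. by apply/lfunP => x; rewrite !dual_lactE antipodeM lactM. Qed.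
Fact dual_ract1 X xi : @dual_ract X xi 1 = xi.
Proof. by apply/lfunP => x; rewrite dual_ractE antipodeV1 ract1. Qed.
Fact dual_ractM X xi g h :
  @dual_ract X xi (g * h) = dual_ract (dual_ract xi g) h.
Proof. by apply/lfunP => x; rewrite !dual_ractE antipodeVM ractM. Qed.
Fact dual_lractA X g xi h :
  @dual_ract X (dual_lact g xi) h = dual_lact g (dual_ract xi h).
Proof.
by apply/lfunP => x; rewrite !(dual_lactE, dual_ractE) lractA.
Qed.

Definition dual_bimod X : bimodule H :=
  @Bimodule k H 'Hom(X, k^o) _ _
    (dual_lact_bilinear X) (dual_ract_bilinear X) (@dual_lact1 X)
    (@dual_lactM X) (@dual_ract1 X) (@dual_ractM X) (@dual_lractA X).

Definition transpose X Y (f : 'Hom(X, Y)) : 'Hom(dual_bimod Y, dual_bimod X) :=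
  linfun (fun xi : 'Hom(Y, k^o) => (xi \o f)%VF).

Lemma transposeE X Y (f : 'Hom(X, Y)) (xi : 'Hom(Y, k^o)) :
  transpose f xi = (xi \o f)%VF.
Proof.
by apply: linfunP => c zeta theta; rewrite comp_lfunDl comp_lfunZl.
Qed.

Definition dual_bimod_mor X Y (f : bimod_hom X Y) :
  bimod_hom (dual_bimod Y) (dual_bimod X).
Proof.
exists (transpose f) => [h xi|xi h]; rewrite !transposeE; apply/lfunP => x.
- by rewrite comp_lfunE !dual_lactE comp_lfunE bimod_homl.
- by rewrite comp_lfunE !dual_ractE comp_lfunE bimod_homr.
Defined.

Fact dual_bimod_mor_id X : dual_bimod_mor (bimod_id X) = bimod_id _.
Proof.
apply: bimod_hom_eq => xi; rewrite transposeE.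
by apply/lfunP => x; rewrite comp_lfunE !id_lfunE.
Qed.

Fact dual_bimod_mor_comp X Y Z (f : bimod_hom X Y) (g : bimod_hom Y Z) :
  dual_bimod_mor (bimod_comp g f)
  = bimod_comp (dual_bimod_mor f) (dual_bimod_mor g).
Proof.
apply: bimod_hom_eq => xi; rewrite transposeE.
apply/lfunP => x; rewrite [in RHS]comp_lfunE [in RHS]transposeE.
by rewrite transposeE !comp_lfunE.
Qed.

Definition dual_functor : functor (op (Bimod H)) (Bimod H) :=
  @Functor (op (Bimod H)) (Bimod H) dual_bimod
    (fun X Y f => dual_bimod_mor f) dual_bimod_mor_id
    (fun X Y Z f g => dual_bimod_mor_comp f g).

Definition dual_tensor_functor :
    functor (prod_cat (op (Bimod H)) (Bimod H)) (Bimod H) :=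
  comp_functor (tensor_functor H)
    (prod_functor dual_functor (id_functor (Bimod H))).

End DualBimodule.

Section CoadjointBimodule.
Variables (k : fieldType) (H : ribbonHopfAlgType k).
Local Notation S := (@antipode k H).
Local Notation SV := (@antipodeV k H).
Local Notation K := 'Hom(tensor H H, k^o).

Definition coadj_lact (h : H) (f : K) : K :=
  tlift (fun a b => sweedler (fun h1 h2 => f ((S h1 * a * h2) ⊗ b)) h).
Definition coadj_ract (f : K) (h : H) : K :=
  tlift (fun a b => sweedler (fun h1 h2 => f (a ⊗ (h2 * b * SV h1))) h).

Lemma coadj_lactE h f a b : coadj_lact h f (a ⊗ b)
  = sweedler (fun h1 h2 => f ((S h1 * a * h2) ⊗ b)) h.
Proof. by rewrite /coadj_lact tliftE //; blin. Qed.
Lemma coadj_ractE f h a b : coadj_ract f h (a ⊗ b)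
  = sweedler (fun h1 h2 => f (a ⊗ (h2 * b * SV h1))) h.
Proof. by rewrite /coadj_ract tliftE //; blin. Qed.

Lemma form_eqP (f g : K) : (forall a b, f (a ⊗ b) = g (a ⊗ b)) -> f = g.
Proof. by move=> fg; apply/lfunP; apply: tensor_eqP fg; lin. Qed.

Lemma coadj_lact_bilinear : bilinear_map coadj_lact.
Proof.
split=> [f|h] c u v; apply: form_eqP => a b;
  rewrite add_lfunE scale_lfunE !coadj_lactE.
- exact: sweedler_lin.
- have l : linear (fun f : K =>
      sweedler (fun h1 h2 => f ((S h1 * a * h2) ⊗ b)) h) by blin.
  exact: l.
Qed.
Lemma coadj_ract_bilinear : bilinear_map coadj_ract.
Proof.
split=> [h|f] c u v; apply: form_eqP => a b;
  rewrite add_lfunE scale_lfunE !coadj_ractE.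
- have l : linear (fun f : K =>
      sweedler (fun h1 h2 => f (a ⊗ (h2 * b * SV h1))) h) by blin.
  exact: l.
- exact: sweedler_lin.
Qed.

Fact coadj_lact1 f : coadj_lact 1 f = f.
Proof.
apply: form_eqP => a b; rewrite coadj_lactE sweedler1; last by blin.
by rewrite antipode1 mul1r mulr1.
Qed.
Fact coadj_ract1 f : coadj_ract f 1 = f.
Proof.
apply: form_eqP => a b; rewrite coadj_ractE sweedler1; last by blin.
by rewrite antipodeV1 mul1r mulr1.
Qed.
Fact coadj_lactM g h f :
  coadj_lact (g * h) f = coadj_lact g (coadj_lact h f).
Proof.
apply: form_eqP => a b; rewrite !coadj_lactE sweedlerM; last by blin.
apply: eq_sweedler => c d; rewrite coadj_lactE; apply: eq_sweedler => x y.
by rewrite antipodeM !mulrA.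
Qed.
Fact coadj_ractM f g h :
  coadj_ract f (g * h) = coadj_ract (coadj_ract f g) h.
Proof.
apply: form_eqP => a b; rewrite !coadj_ractE sweedlerM; last by blin.
rewrite /sweedler tlift_exchange.
apply: eq_sweedler => c d; rewrite coadj_ractE; apply: eq_sweedler => x y.
by rewrite antipodeVM !mulrA.
Qed.
Fact coadj_lractA g f h :
  coadj_ract (coadj_lact g f) h = coadj_lact g (coadj_ract f h).
Proof.
apply: form_eqP => a b; rewrite coadj_lactE coadj_ractE.
under eq_sweedler => x y do rewrite coadj_lactE.
under [RHS]eq_sweedler => x y do rewrite coadj_ractE.
by rewrite /sweedler tlift_exchange.
Qed.

Definition coadj_bimod : Bimod H :=
  @Bimodule k H K _ _ coadj_lact_bilinear coadj_ract_bilinear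
    coadj_lact1 coadj_lactM coadj_ract1 coadj_ractM coadj_lractA.

(* The canonical isomorphism from H^* (x) H^* to the carrier of coadj_bimod.  *)
Definition form_of_tensor : 'Hom(tensor 'Hom(H, k^o) 'Hom(H, k^o), K) :=
  tlift (fun f g : 'Hom(H, k^o) => tlift (fun a b => f a * g b)).

Lemma form_of_tensorE (f g : 'Hom(H, k^o)) a b :
  form_of_tensor (f ⊗ g) (a ⊗ b) = f a * g b.
Proof.
have bl (u v : 'Hom(H, k^o)) : bilinear_map (fun a b => u a * v b).
  by split=> [?|?]; [apply: lin_mull; lin|apply: lin_mulr; lin].
rewrite /form_of_tensor tliftE ?tliftE //.
split=> [u|u] c v w; apply: form_eqP => x y;
  rewrite add_lfunE scale_lfunE !tliftE // add_lfunE scale_lfunE.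
- by rewrite mulrDl scalerAl.
- by rewrite mulrDr scalerAr.
Qed.

Lemma form_of_tensor_bij : bijective form_of_tensor.
Proof.
pose e (i : 'I_(dim H)) : 'Hom(H, k^o) := linfun (fun a : H => v2r a 0 i : k^o).
have eE i a : e i a = v2r a 0 i.
  by rewrite /e linfunP // => c u v; rewrite linearP !mxE.
have es (f : 'Hom(H, k^o)) : f = \sum_i (f (stdvec i) : k) *: e i.
  apply/lfunP => a; rewrite {1}(stdvec_sum a) linear_sum sum_lfunE.
  apply: eq_bigr => i _; rewrite linearZ scale_lfunE eE; exact: mulrC.
pose G (F : K) := \sum_i \sum_j (F (stdvec i ⊗ stdvec j) : k) *: (e i ⊗ e j).
have lG : linear G.
  move=> c u v; rewrite /G scaler_sumr -big_split; apply: eq_bigr => i _ /=.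
  rewrite scaler_sumr -big_split; apply: eq_bigr => j _ /=.
  by rewrite add_lfunE scale_lfunE scalerDl -scalerA.
exists G => [t|F].
  move: t; apply: tensor_eqP; [|exact: lin_id|move=> f g].
    by apply: lin_comp lG; lin.
  rewrite [in RHS](es f) (lin_sum _ _ _ (tens_linl _)); apply: eq_bigr => i _.
  rewrite [in RHS](es g) (lin_sum _ _ _ (tens_linr _)) scaler_sumr.
  by apply: eq_bigr => j _; rewrite form_of_tensorE scalerA.
apply: form_eqP => a b; rewrite /G linear_sum sum_lfunE.
rewrite [in RHS](stdvec_sum a) (lin_sum _ _ _ (tens_linl _)) linear_sum.
apply: eq_bigr => i _; rewrite linear_sum sum_lfunE linearZ /=.
rewrite [in RHS](stdvec_sum b) (lin_sum _ _ _ (tens_linr _)) linear_sum.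
rewrite scaler_sumr; apply: eq_bigr => j _.
rewrite !linearZ scale_lfunE form_of_tensorE !eE.
have swap (x y z : k) : x * (y * z) = z * (y * x).
  by rewrite mulrC -mulrA mulrCA.
exact: swap.
Qed.

End CoadjointBimodule.

(* Main.v *)
Require Import Defs.
Set Warnings "-notation-overridden,-ambiguous-paths".
From mathcomp Require Import all_boot all_algebra all_field.

Import GRing.Theory.
Local Open Scope ring_scope.

(** The bimodule F = H (x) H with a.(x (x) y).b = ax (x) yb is free on 1 (x) 1:
    every x in X is the image of 1 (x) 1 under a unique bimodule map F -> X,
    namely a (x) b |-> a.x.b, and the pullback of xi along that map is exactly
    iota_X (xi (x) x). Hence iota_F (f (x) (1 (x) 1)) = f, so a morphism kappa
    with kappa o iota = phi has to be f |-> phi_F (f (x) (1 (x) 1));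
    dinaturality of phi along the maps F -> X shows that this kappa works. *)

Section FreeBimodule.
Variables (k : fieldType) (H : falgType k).

Definition free_lact (h : H) (t : tensor H H) : tensor H H :=
  tlift (fun a b => (h * a) ⊗ b) t.
Definition free_ract (t : tensor H H) (h : H) : tensor H H :=
  tlift (fun a b => a ⊗ (b * h)) t.

Lemma free_lactE h a b : free_lact h (a ⊗ b) = (h * a) ⊗ b.
Proof. by rewrite /free_lact tliftE //; blin. Qed.
Lemma free_ractE a b h : free_ract (a ⊗ b) h = a ⊗ (b * h).
Proof. by rewrite /free_ract tliftE //; blin. Qed.

Lemma free_lact_bilinear : bilinear_map free_lact.
Proof. by rewrite /free_lact; blin. Qed.
Lemma free_ract_bilinear : bilinear_map free_ract.
Proof. by rewrite /free_ract; blin. Qed.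

Fact free_lact1 t : free_lact 1 t = t.
Proof.
move: t; apply: tensor_eqP => [||a b]; first exact: free_lact_bilinear.2.
  exact: lin_id.
by rewrite free_lactE mul1r.
Qed.
Fact free_ract1 t : free_ract t 1 = t.
Proof.
move: t; apply: tensor_eqP => [||a b]; first exact: free_ract_bilinear.1.
  exact: lin_id.
by rewrite free_ractE mulr1.
Qed.
Fact free_lactM g h t : free_lact (g * h) t = free_lact g (free_lact h t).
Proof.
have [_ l] := free_lact_bilinear.
move: t; apply: tensor_eqP => [||a b]; [exact: l|exact: lin_comp (l h) (l g)|].
by rewrite !free_lactE mulrA.
Qed.
Fact free_ractM t g h : free_ract t (g * h) = free_ract (free_ract t g) h.
Proof.
have [l _] := free_ract_bilinear.
move: t; apply: tensor_eqP => [||a b]; [exact: l|exact: lin_comp (l g) (l h)|].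
by rewrite !free_ractE mulrA.
Qed.
Fact free_lractA g t h :
  free_ract (free_lact g t) h = free_lact g (free_ract t h).
Proof.
have [[_ l] [r _]] := (free_lact_bilinear, free_ract_bilinear).
move: t; apply: tensor_eqP => [||a b].
- exact: lin_comp (l g) (r h).
- exact: lin_comp (r h) (l g).
by rewrite !(free_lactE, free_ractE).
Qed.

Definition free_bimod : bimodule H :=
  @Bimodule k H (tensor H H) _ _ free_lact_bilinear free_ract_bilinear
    free_lact1 free_lactM free_ract1 free_ractM free_lractA.

Definition orbit_lfun {X : bimodule H} (x : X) : 'Hom(tensor H H, X) :=
  tlift (fun a b => ract (lact a x) b).

Lemma orbit_lfunE (X : bimodule H) (x : X) a b :
  orbit_lfun x (a ⊗ b) = ract (lact a x) b.
Proof. by rewrite /orbit_lfun tliftE //; blin. Qed.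

(** Compatibility on the left rests on the two actions of [X] commuting, as [b] acts after [h * a];
    on the right, associativity of the right action is enough. *)
Definition orbit_hom {X : bimodule H} (x : X) : bimod_hom free_bimod X.
Proof.
exists (orbit_lfun x) => [h t|t h] /=.
- have [_ l] := free_lact_bilinear.
  move: t; apply: tensor_eqP => [||a b].
  + by apply: lin_lfun; apply: l.
  + by apply: lin_lactr; lin.
  by rewrite free_lactE !orbit_lfunE lactM lractA.
- have [r _] := free_ract_bilinear.
  move: t; apply: tensor_eqP => [||a b].
  + by apply: lin_lfun; apply: r.
  + by apply: lin_ractl; lin.
  by rewrite free_ractE !orbit_lfunE ractM.
Defined.

Lemma orbit_hom1 (X : bimodule H) (x : X) : orbit_hom x (1 ⊗ 1) = x.
Proof. by rewrite /= orbit_lfunE lact1 ract1. Qed.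

End FreeBimodule.

Arguments free_bimod {k} H.
Arguments orbit_lfun {k H X} x.
Arguments orbit_hom {k H X} x.

Section CoadjointCoend.
Variables (k : fieldType) (H : ribbonHopfAlgType k).
Local Notation K := 'Hom(tensor H H, k^o).

(** Written as a pullback along the orbit map so that dinaturality along [orbit_hom x] applies to it
    directly. *)
Definition coadj_iota_lfun (X : bimodule H) :
    'Hom(tensor 'Hom(X, k^o) X, K) :=
  tlift (fun xi x => (xi \o orbit_lfun x)%VF).

Lemma coadj_iota_lfunE (X : bimodule H) (xi : 'Hom(X, k^o)) (x : X) :
  coadj_iota_lfun X (xi ⊗ x) = (xi \o orbit_lfun x)%VF.
Proof.
rewrite /coadj_iota_lfun tliftE //; split=> [y|zeta] c u v.
  by rewrite comp_lfunDl comp_lfunZl.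
apply: form_eqP => a b; rewrite add_lfunE scale_lfunE !comp_lfunE !orbit_lfunE.
have l : linear (fun x : X => zeta (ract (lact a x) b)) by blin.
exact: l.
Qed.

Lemma coadj_iota_lfun_eval (X : bimodule H) (xi : 'Hom(X, k^o)) (x : X) a b :
  coadj_iota_lfun X (xi ⊗ x) (a ⊗ b) = xi (ract (lact a x) b).
Proof. by rewrite coadj_iota_lfunE comp_lfunE orbit_lfunE. Qed.

(** At [a ⊗ b] both sides agree termwise in the Sweedler sum: the dual action puts [S h1] in front
    of [a] and [h2] acts on [x] behind it, giving xi(S(h1) a h2 . x . b). *)
Lemma coadj_iota_lactE (X : bimodule H) h (t : tensor (dual_bimod X) X) :
  coadj_iota_lfun X (tensor_lact h t) = coadj_lact h (coadj_iota_lfun X t).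
Proof.
have [_ l] := tensor_lact_bilinear (dual_bimod X) X.
have [_ l'] := coadj_lact_bilinear H.
move: t; apply: tensor_eqP => [||xi x].
- by apply: lin_lfun; apply: l.
- by apply: lin_comp (l' h); lin.
apply: form_eqP => a b; rewrite tensor_lactE coadj_lactE /sweedler.
have le : linear (fun t : tensor 'Hom(X, k^o) X =>
  coadj_iota_lfun X t (a ⊗ b)) by lin.
rewrite (lin_tlift _ _ le); apply: eq_tlift => h1 h2.
by rewrite !coadj_iota_lfun_eval dual_lactE lractA !lactM !lractA.
Qed.

(** The common value at [a ⊗ b] is the sum of the xi(a . x . h2 b S^-1(h1)): [h2] acts on [x] before
    [b], while the dual action contributes S^-1(h1) last. *)
Lemma coadj_iota_ractE (X : bimodule H) (t : tensor (dual_bimod X) X) h :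
  coadj_iota_lfun X (tensor_ract t h) = coadj_ract (coadj_iota_lfun X t) h.
Proof.
have [r _] := tensor_ract_bilinear (dual_bimod X) X.
have [r' _] := coadj_ract_bilinear H.
move: t; apply: tensor_eqP => [||xi x].
- by apply: lin_lfun; apply: r.
- by apply: lin_comp (r' h); lin.
apply: form_eqP => a b; rewrite tensor_ractE coadj_ractE /sweedler.
have le : linear (fun t : tensor 'Hom(X, k^o) X =>
  coadj_iota_lfun X t (a ⊗ b)) by lin.
rewrite (lin_tlift _ _ le); apply: eq_tlift => h1 h2.
by rewrite !coadj_iota_lfun_eval dual_ractE !ractM !lractA.
Qed.

Definition coadj_iota (X : Bimod H) :
    mor (dual_tensor_functor H (X, X)) (coadj_bimod H) :=
  @BimodHom k H (tensor_bimod (dual_bimod X) X) (coadj_bimod H)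
    (coadj_iota_lfun X) (@coadj_iota_lactE X) (@coadj_iota_ractE X).

(** The dual of the free bimodule has the same underlying space as the coadjoint bimodule, so [f] is
    itself a form to evaluate. This gives a linear section of iota at the free bimodule. *)
Lemma coadj_iota_free (f : K) :
  coadj_iota_lfun (free_bimod H) (f ⊗ (1 ⊗ 1)) = f.
Proof.
apply: form_eqP => a b.
by rewrite coadj_iota_lfun_eval /= free_lactE free_ractE mulr1 mul1r.
Qed.

(** Morphisms out of a tensor product are determined on elementary tensors, and transposition is
    precomposition. *)
Lemma dinaturalE (B : Bimod H)
    (phi : forall X : Bimod H, mor (dual_tensor_functor H (X, X)) B) :
  dinatural phi <->
  forall (X Y : bimodule H) (f : bimod_hom X Y) (xi : 'Hom(Y, k^o)) (x : X),
    (phi Y : bimod_hom _ _) (xi ⊗ f x)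
    = (phi X : bimod_hom _ _) ((xi \o f)%VF ⊗ x).
Proof.
split=> [nat X Y f xi x|nat X Y f].
  have /(congr1 (fun m : bimod_hom (tensor_bimod (dual_bimod Y) X) B =>
    m (xi ⊗ x))) := nat X Y f.
  by rewrite /= !comp_lfunE !tmapE !transposeE comp_lfun1r id_lfunE.
apply: bimod_hom_eq; apply: tensor_eqP => [||xi x] /=; [by lin|by lin|].
by rewrite !comp_lfunE !tmapE !transposeE comp_lfun1r id_lfunE nat.
Qed.

(** Since [f] respects both actions, xi(a . f(x) . b) = xi(f(a . x . b)). *)
Lemma coadj_iota_dinatural : dinatural coadj_iota.
Proof.
apply/dinaturalE => X Y f xi x; apply: form_eqP => a b /=.
by rewrite !coadj_iota_lfun_eval comp_lfunE bimod_homr bimod_homl.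
Qed.

(** Only a linear map at this stage; compatibility with the actions will come from dinaturality. *)
Definition coadj_desc_lfun (B : bimodule H)
    (phi : 'Hom(tensor 'Hom(free_bimod H, k^o) (free_bimod H), B)) :
    'Hom(K, B) :=
  linfun (fun f : K => phi (f ⊗ (1 ⊗ 1))).

Lemma coadj_desc_lfunE B phi (f : K) :
  coadj_desc_lfun B phi f = phi (f ⊗ (1 ⊗ 1)).
Proof. by rewrite /coadj_desc_lfun linfunP //; lin. Qed.

Lemma coadj_desc_iota (B : Bimod H)
    (phi : forall X : Bimod H, mor (dual_tensor_functor H (X, X)) B)
    (X : bimodule H) : dinatural phi ->
  forall t, coadj_desc_lfun B (phi (free_bimod H) : bimod_hom _ _)
      (coadj_iota_lfun X t) = (phi X : bimod_hom _ _) t.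
Proof.
move=> /dinaturalE nat; apply: tensor_eqP => [||xi x]; [by lin|by lin|].
rewrite coadj_desc_lfunE coadj_iota_lfunE.
(* Dinaturality moves the orbit map from the form [xi] to the vector [1 ⊗ 1], which it sends to
   [x]. *)
by rewrite -(nat _ _ (orbit_hom x)) orbit_hom1.
Qed.

Definition coadj_desc (B : Bimod H)
    (phi : forall X : Bimod H, mor (dual_tensor_functor H (X, X)) B) :
  dinatural phi -> mor (coadj_bimod H) B.
Proof.
move=> nat.
exists (coadj_desc_lfun B (phi (free_bimod H) : bimod_hom _ _)) => [h f|f h] /=.
(* The section [f] to [f ⊗ (1 ⊗ 1)] need not respect the actions. Instead [h] acts on [f] through
   iota, and on the image of iota the map is given by [phi], a bimodule morphism. *)
- rewrite -{1}(coadj_iota_free f) -coadj_iota_lactE.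
  by rewrite coadj_desc_iota // coadj_desc_lfunE bimod_homl.
- rewrite -{1}(coadj_iota_free f) -coadj_iota_ractE.
  by rewrite coadj_desc_iota // coadj_desc_lfunE bimod_homr.
Defined.

Lemma coadj_iota_coend :
  is_coend (dual_tensor_functor H) (coadj_bimod H) coadj_iota.
Proof.
split=> [|B phi nat]; first exact: coadj_iota_dinatural.
exists (coadj_desc B phi nat); split=> [X|kappa kappaE].
  by apply: bimod_hom_eq => t /=; rewrite comp_lfunE coadj_desc_iota.
(* Uniqueness: the condition on [kappa] at the free bimodule, evaluated on [f ⊗ (1 ⊗ 1)], determines
   [kappa f]. *)
apply: bimod_hom_eq => f /=; rewrite coadj_desc_lfunE -kappaE /= comp_lfunE.
by rewrite coadj_iota_free.
Qed.

End CoadjointCoend.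

Theorem propositionA6 (k : closedFieldType) (k_char0 : [pchar k] =i pred0)
    (H : ribbonHopfAlgType k) :
  exists iota : forall X : Bimod H,
      mor (dual_tensor_functor H (X, X)) (coadj_bimod H),
    (forall (X : Bimod H) (xi : 'Hom(X, k^o)) (x : X) (a b : H),
       (iota X (xi ⊗ x) : 'Hom(tensor H H, k^o)) (a ⊗ b)
       = xi (ract (lact a x) b)) /\
    is_coend (dual_tensor_functor H) (coadj_bimod H) iota.
Proof.
exists (coadj_iota k H); split; last exact: coadj_iota_coend.
exact: coadj_iota_lfun_eval.
Qed.
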